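(* Let $k$ be a field of characteristic $p>0$. Let $E=(G,a,c,\alpha)$ be a tuple where $G$ is a finite group, $a\in Z(G)$ has order divisible by $p$, $c:G\to(k,+)$ is a group homomorphism, $\alpha\in k$, and, if $a^p\ne1$, $c(g)\in\mathbb{F}_p$ for all $g\in G$. Then the Hopf algebra $H_E$ is well-defined, where $H_E$ is the algebra with basis $(gx^i)_{g\in G,\,0\le i\le p-1}$ and relations $gxg^{-1}=x+c(g)(a-1)$ for all $g\in G$ and $x^p=x+\alpha(a^p-1)$, whose Hopf algebra structure is determined by the linear maps $\Delta$, $\epsilon$, $S$ with $\Delta(gx^i)=(g\otimes g)(x\otimes a+1\otimes x)^i$, $\epsilon(gx^i)=\delta_{i,0}$ and $S(gx^i)=(-xa^{-1})^ig^{-1}$ for all $g\in G$ and $0\le i\le p-1$.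
   Context: $\mathbb{F}_p$ denotes the prime field of $k$ and $Z(G)$ the center of $G$. $H_E$ contains the group algebra $kG$ and an additional generator $x$.
   Formalization: It is additionally assumed that c(a) is a nonzero element of F_p; without this Δ does not respect the relation x^p = x + α(a^p − 1) (for instance c(a) = 0 would force a^p = a), so the claim fails. *)

(* Defs.v *)
From HB Require Import structures.
From mathcomp Require Import all_boot all_order all_fingroup all_algebra all_solvable all_field.

Set Implicit Arguments.
Unset Strict Implicit.
Unset Printing Implicit Defensive.

Import GRing.Theory.
Local Open Scope ring_scope.

(* The tensor product of two finite-dimensional spaces, represented by
   coordinate matrices in the canonical bases [vbasis {:U}] and [vbasis {:V}].
   The lemmas [tliftE] and [tensor_ind] below give its universal property, so
   nothing depends on the choice of these bases. *)
Definition tensor (K : fieldType) (U V : vectType K) : Type :=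
  'M[K]_(\dim {:U}, \dim {:V}).

HB.instance Definition _ (K : fieldType) (U V : vectType K) :=
  Vector.copy (tensor U V) 'M[K]_(\dim {:U}, \dim {:V}).

Section Tensor.
Variable K : fieldType.

Definition tens (U V : vectType K) (u : U) (v : V) : tensor U V :=
  \matrix_(i, j) (coord (vbasis {:U}) i u * coord (vbasis {:V}) j v).

(* The linear map on the tensor product induced by a bilinear map f. *)
Definition tlift (U V : vectType K) (W : lmodType K) (f : U -> V -> W)
    (t : tensor U V) : W :=
  \sum_i \sum_j t i j *: f (vbasis {:U})`_i (vbasis {:V})`_j.

Definition bilin (U V W : lmodType K) (f : U -> V -> W) : Prop :=
  (forall v, linear (fun u => f u v)) /\ (forall u, linear (f u)).

Lemma linear_fsum (U W : lmodType K) (f : U -> W) (I : finType) (r : I -> K)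
    (e : I -> U) :
  linear f -> f (\sum_i r i *: e i) = \sum_i r i *: f (e i).
Proof.
move=> lf; pose m := GRing.isLinear.Build K U W _ f lf.
pose F : {linear U -> W} := HB.pack f m.
rewrite -[f]/(F : U -> W) linear_sum.
by apply: eq_bigr => i _; rewrite linearZ.
Qed.

Section Two.
Variables U V : vectType K.

Lemma tens_bilin : bilin (@tens U V).
Proof.
by split=> [v|u] a w1 w2; apply/matrixP=> i j; rewrite !mxE linearP /=;
  [rewrite mulrDl mulrA | rewrite mulrDr mulrCA].
Qed.

Lemma tlift_linear (W : lmodType K) (f : U -> V -> W) : linear (tlift f).
Proof.
move=> a s t; rewrite /tlift scaler_sumr -big_split /=; apply: eq_bigr => i _.
rewrite scaler_sumr -big_split /=; apply: eq_bigr => j _.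
by rewrite !mxE scalerDl scalerA.
Qed.

Lemma tliftE (W : lmodType K) (f : U -> V -> W) u v :
  bilin f -> tlift f (tens u v) = f u v.
Proof.
case=> fl fr; rewrite [in RHS](coord_vbasis (memvf u)).
rewrite (linear_fsum _ _ (fl v)); apply: eq_bigr => i _.
rewrite [in RHS](coord_vbasis (memvf v)) (linear_fsum _ _ (fr _)) scaler_sumr.
by apply: eq_bigr => j _; rewrite mxE scalerA.
Qed.

Lemma tensE (t : tensor U V) : tlift (@tens U V) t = t.
Proof.
apply/matrixP=> i j; rewrite /tlift summxE (bigD1 i) //= summxE (bigD1 j) //=.
rewrite !mxE !coord_free ?(basis_free (vbasisP _)) // !eqxx !mulr1.
rewrite !big1 ?addr0 // => [k ki|l lj].
  rewrite summxE big1 // => l _; rewrite !mxE coord_free ?(basis_free (vbasisP _)) //.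
  by rewrite (negbTE ki) mul0r mulr0.
rewrite !mxE [coord _ j _]coord_free ?(basis_free (vbasisP _)) //.
by rewrite (negbTE lj) !mulr0.
Qed.

Lemma tensor_ind (W : lmodType K) (f g : tensor U V -> W) :
    linear f -> linear g -> (forall u v, f (tens u v) = g (tens u v)) ->
  f =1 g.
Proof.
move=> lf lg fg t; rewrite -(tensE t) /tlift.
pose F : {linear tensor U V -> W} := HB.pack f (GRing.isLinear.Build K _ W _ f lf).
pose G : {linear tensor U V -> W} := HB.pack g (GRing.isLinear.Build K _ W _ g lg).
rewrite -[f]/(F : _ -> W) -[g]/(G : _ -> W) !linear_sum; apply: eq_bigr => i _.
rewrite !linear_sum; apply: eq_bigr => j _; rewrite !linearZ /=.
by congr (_ *: _); apply: fg.
Qed.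

End Two.

Definition tmap (U V U' V' : vectType K) (f : U -> U') (g : V -> V') :
    tensor U V -> tensor U' V' :=
  tlift (fun u v => tens (f u) (g v)).

Definition tassoc (U V W : vectType K) :
    tensor (tensor U V) W -> tensor U (tensor V W) :=
  tlift (fun t w => tlift (fun u v => tens u (tens v w)) t).

End Tensor.

Section TensorAlgebra.
Variables (K : fieldType) (A B : falgType K).
Implicit Types (s t : tensor A B) (a : A) (b : B).

Definition tmul s t : tensor A B :=
  tlift (fun a b => tlift (fun a' b' => tens (a * a') (b * b')) t) s.

Let mulf_bilin a b : bilin (fun a' b' => tens (a * a') (b * b')).
Proof.
have [tl tr] := tens_bilin A B.
by split=> [v|u] x w1 w2; rewrite mulrDr -scalerAr ?tl ?tr.
Qed.

Let tmul_bilin_aux t :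
  bilin (fun a b => tlift (fun a' b' => tens (a * a') (b * b')) t).
Proof.
have [tl tr] := tens_bilin A B.
split=> [v|u] x w1 w2; rewrite /tlift scaler_sumr -big_split /=;
  apply: eq_bigr => i _; rewrite scaler_sumr -big_split /=;
  apply: eq_bigr => j _; rewrite mulrDl -scalerAl ?tl ?tr;
  by rewrite scalerDr !scalerA [x * _]mulrC.
Qed.

Lemma tmulE a b a' b' :
  tmul (tens a b) (tens a' b') = tens (a * a') (b * b').
Proof. by rewrite /tmul tliftE // tliftE. Qed.

Lemma tmul_linearl t : linear (tmul^~ t).
Proof. exact: tlift_linear. Qed.

Lemma tmul_linearr s : linear (tmul s).
Proof.
move=> x t1 t2; rewrite /tmul ![tlift _ s]/tlift.
rewrite scaler_sumr -big_split /=; apply: eq_bigr => i _.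
rewrite scaler_sumr -big_split /=; apply: eq_bigr => j _.
rewrite tlift_linear.
by rewrite scalerDr !scalerA [x * _]mulrC.
Qed.

Let lin_comp (U V W : lmodType K) (g : V -> W) (f : U -> V) :
  linear g -> linear f -> linear (fun u => g (f u)).
Proof. by move=> lg lf x u v; rewrite lf lg. Qed.

Fact tmulA : associative tmul.
Proof.
move=> s t w.
apply: (tensor_ind (f := fun s => tmul s (tmul t w))
  (g := fun s => tmul (tmul s t) w)) => [||a b].
- exact: tmul_linearl.
- exact: lin_comp (tmul_linearl w) (tmul_linearl t).
apply: (tensor_ind (f := fun t => tmul (tens a b) (tmul t w))
  (g := fun t => tmul (tmul (tens a b) t) w)) => [||a' b'].
- exact: lin_comp (tmul_linearr _) (tmul_linearl w).
- exact: lin_comp (tmul_linearl w) (tmul_linearr _).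
apply: (tensor_ind (f := fun w => tmul (tens a b) (tmul (tens a' b') w))
  (g := tmul (tmul (tens a b) (tens a' b')))) => [||a'' b''].
- exact: lin_comp (tmul_linearr _) (tmul_linearr _).
- exact: tmul_linearr.
by rewrite !tmulE !mulrA.
Qed.

Fact tmul1l : left_id (tens 1 1) tmul.
Proof.
apply: (tensor_ind (f := tmul (tens 1 1)) (g := id)) => // [|a b].
  exact: tmul_linearr.
by rewrite tmulE !mul1r.
Qed.

Fact tmul1r : right_id (tens 1 1) tmul.
Proof.
apply: (tensor_ind (f := fun s => tmul s (tens 1 1)) (g := id)) => // [|a b].
  exact: tmul_linearl.
by rewrite tmulE !mulr1.
Qed.

Fact tmulDl : left_distributive tmul +%R.
Proof. by move=> s t w; have:= tmul_linearl w 1 s t; rewrite !scale1r. Qed.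

Fact tmulDr : right_distributive tmul +%R.
Proof. by move=> s t w; have:= tmul_linearr s 1 t w; rewrite !scale1r. Qed.

Fact tens11_neq0 : tens (1 : A) (1 : B) != 0.
Proof.
have coord_neq0 (C : falgType K) : exists i, coord (vbasis {:C}) i 1 != 0.
  apply/existsP; apply: contraNT (oner_neq0 C) => /existsPn c0.
  rewrite (coord_vbasis (memvf 1)) big1 // => i _.
  by move/negPn/eqP: (c0 i) => ->; rewrite scale0r.
have [[i ci] [j cj]] := (coord_neq0 A, coord_neq0 B).
apply/eqP=> /matrixP/(_ i j)/eqP; rewrite !mxE mulf_eq0.
by rewrite (negbTE ci) (negbTE cj).
Qed.

HB.instance Definition _ := GRing.Zmodule_isNzRing.Build (tensor A B)
  tmulA tmul1l tmul1r tmulDl tmulDr tens11_neq0.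

Fact tmul_scalel (x : K) s t : x *: (s * t) = (x *: s) * t.
Proof. by have:= tmul_linearl t x s 0; rewrite /= -![tmul _ t]/(_ * t) mul0r !addr0. Qed.

Fact tmul_scaler (x : K) s t : x *: (s * t) = s * (x *: t).
Proof. by have:= tmul_linearr s x t 0; rewrite /= -![tmul s _]/(s * _) mulr0 !addr0. Qed.

HB.instance Definition _ :=
  GRing.Lmodule_isLalgebra.Build K (tensor A B) tmul_scalel.
HB.instance Definition _ :=
  GRing.Lalgebra_isAlgebra.Build K (tensor A B) tmul_scaler.
HB.instance Definition _ := Algebra_isFalgebra.Build K (tensor A B).

Lemma tensM a b a' b' : tens a b * tens a' b' = tens (a * a') (b * b').
Proof. exact: tmulE. Qed.

Lemma tens1 : tens (1 : A) (1 : B) = 1.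
Proof. by []. Qed.

End TensorAlgebra.

Record hopf_maps (K : fieldType) (H : falgType K) := HopfMaps {
  comul : 'Hom(H, tensor H H);
  counit : 'Hom(H, K^o);
  antipode : 'Hom(H, H)
}.

Record is_hopf_algebra (K : fieldType) (H : falgType K) (D : hopf_maps H) :
    Prop := IsHopfAlgebra {
  hopf_coassoc : forall u,
    tassoc (tmap (comul D) id (comul D u)) = tmap id (comul D) (comul D u);
  hopf_counitl : forall u, tlift (fun v w => counit D v *: w) (comul D u) = u;
  hopf_counitr : forall u, tlift (fun v w => counit D w *: v) (comul D u) = u;
  hopf_comul1 : comul D 1 = 1;
  hopf_comulM : forall u v, comul D (u * v) = comul D u * comul D v;
  hopf_counit1 : counit D 1 = 1;
  hopf_counitM : forall u v, counit D (u * v) = counit D u * counit D v;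
  hopf_antipodel : forall u,
    tlift (fun v w => antipode D v * w) (comul D u) = counit D u *: 1;
  hopf_antipoder : forall u,
    tlift (fun v w => v * antipode D w) (comul D u) = counit D u *: 1
}.

(* When R has prime characteristic, the elements n%:R (n : nat) already form
   its prime subfield. *)
Definition in_prime_field (R : nzRingType) (z : R) : Prop :=
  exists n : nat, z = n%:R.

Section HE.
Variables (k : fieldType) (p : nat) (G : finGroupType) (a : G) (c : G -> k)
  (alpha : k).

(* H, with the map gen : G -> H and the element x, is the algebra H_E. *)
Record is_HE (H : falgType k) (gen : G -> H) (x : H) : Prop := IsHE {
  HE_basis : basis_of {:H} [seq gen g * x ^+ i | g <- enum G, i <- iota 0 p];
  HE_gen1 : gen 1%g = 1;
  HE_genM : forall g h, gen (g * h)%g = gen g * gen h;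
  HE_conj : forall g, gen g * x * gen g^-1%g = x + c g *: (gen a - 1);
  HE_pow : x ^+ p = x + alpha *: (gen a ^+ p - 1)
}.

Record HE_formulas (H : falgType k) (gen : G -> H) (x : H) (D : hopf_maps H) :
    Prop := HEFormulas {
  HE_comul : forall g i, (i < p)%N ->
    comul D (gen g * x ^+ i)
      = tens (gen g) (gen g) * (tens x (gen a) + tens 1 x) ^+ i;
  HE_counit : forall g i, (i < p)%N ->
    counit D (gen g * x ^+ i) = (i == 0)%:R;
  HE_antipode : forall g i, (i < p)%N ->
    antipode D (gen g * x ^+ i)
      = (- (x * gen a^-1%g)) ^+ i * gen g^-1%g
}.

End HE.

(* Main.v *)
Require Import Defs.
From HB Require Import structures.
From mathcomp Require Import all_boot all_order all_fingroup all_algebra all_solvable all_field.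

Set Implicit Arguments.
Unset Strict Implicit.
Unset Printing Implicit Defensive.

Import GRing.Theory.
Local Open Scope ring_scope.

(** Everything rests on one identity in characteristic p.  Write gamma = c(a),
a nonzero element of the prime field, so that a x = (x + gamma (a - 1)) a.
For every t that commutes with x and a,
  (x + (a - 1) t)^p = x^p + (a - 1) t + (a^p - 1) (t^p - t)
([pth_power_comm]).  For t in the prime field, x + t (a - 1) is the conjugate
of x by a power of a, and x^p - x commutes with a, so conjugating
x^p = (x^p - x) + x gives the identity.  The difference of the two sides is a polynomial in
t whose terms of degree p cancel; it has degree less than p and vanishes at the
p elements of the prime field, so it is zero.

Existence of the algebra: let G and x act on the space with basis the symbols
g x^i as left multiplication in H_E should act.  All relations but the one for
x^p are immediate.  That one holds because the defect
R = x^p - x - alpha (a^p - 1) kills the basis vector 1 and commutes with x and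
with every g; the latter is the identity for t = c(g), where
(a^p - 1) (c(g)^p - c(g)) = 0 by the hypothesis on c
([regular_representation]).  The operators g x^i are independent because they
send 1 to distinct basis vectors, and their span is closed under products
([HE_of_free]).

A basis given by g x^i together with the relations yields the universal
property of the presentation ([HE_lift]).  It gives uniqueness up to
isomorphism, and reduces the structure maps to checking the relations on the
proposed images of the generators:
- for the comultiplication, x (x) a + 1 (x) x is the sum of
  1 (x) x + (1 (x) a - 1) (x (x) 1) and x (x) 1, which commute; the identity
  with t = x (x) 1 computes its p-th power ([comul_relations]);
- for the antipode, put s = - x a^-1.  In the algebra of endomorphisms of H
  let t be left multiplication by s; it commutes with the right
  multiplications by x and a.  The operator u |-> s u a + u x sends 1 to
  s a + x = 0, so its p-th power does too, and expanding that power by the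
  identity gives s^p ([antipode_pow]).

The Hopf axioms are then equalities that need only be checked on generators
(a structure map is determined by the given formulas, since these prescribe
it on a basis). *)

(** * The p-th power of x + t(a - 1) *)

Lemma intertwineX (R : nzRingType) (b x y : R) n :
  b * x = y * b -> b * x ^+ n = y ^+ n * b.
Proof.
move=> bx; elim: n => [|n IHn]; first by rewrite !expr0 mulr1 mul1r.
by rewrite !exprS mulrA bx -mulrA IHn mulrA.
Qed.

Lemma expr_pcharD (R : nzRingType) p (x y : R) : p \in [pchar R] ->
  GRing.comm x y -> (x + y) ^+ p = x ^+ p + y ^+ p.
Proof. by move=> charR /(pFrobenius_autD_comm charR). Qed.

Lemma expr_pcharB (R : nzRingType) p (x y : R) : p \in [pchar R] ->
  GRing.comm x y -> (x - y) ^+ p = x ^+ p - y ^+ p.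
Proof. by move=> charR /(pFrobenius_autB_comm charR). Qed.

Section PrimeField.
Variables (k : fieldType) (p : nat).
Hypothesis char_k : p \in [pchar k].

Lemma prime_field_expp (z : k) : in_prime_field z -> z ^+ p = z.
Proof. by case=> n ->; apply: (pFrobenius_aut_nat char_k n). Qed.

(** The inverse of a nonzero m in the prime field is m^(p-2), again an integer;
this provides the exponents n for which a^n conjugates x to x + j (a - 1). *)
Lemma prime_field_div (z : k) j : in_prime_field z -> z <> 0 ->
  exists n, n%:R * z = j%:R.
Proof.
case=> m -> /eqP zn0; have [p' p_eq]: exists p', p = p'.+2.
  by have := prime_gt1 (pcharf_prime char_k); case: (p) => [|[|q]] // _; exists q.
exists (j * m ^ p')%N; rewrite natrM natrX -mulrA -exprSr.
rewrite [X in _ * X](_ : _ = 1) ?mulr1 //; apply: (mulIf zn0).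
by rewrite mul1r -exprSr -p_eq; apply: (pFrobenius_aut_nat char_k m).
Qed.

End PrimeField.

(** Only the product of the n terms b X reaches degree n, so the leading
coefficient is b^n although x and b need not commute. *)
Lemma coef_linear_exp (R : nzRingType) (x b : R) n j : (n <= j)%N ->
  ((x%:P + b%:P * 'X) ^+ n)`_j = b ^+ n *+ (j == n).
Proof.
elim: n j => [|n IHn] j le_nj; first by rewrite expr0 coef1 expr0.
case: j le_nj => // j le_nj.
rewrite exprSr mulrDr coefD coefMC mulrA coefMX /= coefMC !IHn ?(ltnW le_nj) //.
by rewrite (gtn_eqF (leq_trans le_nj _)) // mul0r add0r eqSS mulrnAl -exprSr.
Qed.

Section KeyLemma.
Variables (k : fieldType) (p : nat) (A : falgType k) (a x : A) (gamma : k).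
Hypotheses (char_k : p \in [pchar k]) (a_unit : a \is a GRing.unit).
Hypotheses (gamma_prime : in_prime_field gamma) (gamma_neq0 : gamma <> 0).
Hypothesis conj_a : a * x = (x + gamma *: (a - 1)) * a.

Let char_A : p \in [pchar A].
Proof. by rewrite (pchar_lalg A). Qed.

Let conj_aX n : a ^+ n * x = (x + (n%:R * gamma) *: (a - 1)) * a ^+ n.
Proof.
elim: n => [|n IHn]; first by rewrite mul0r scale0r addr0 mul1r mulr1.
rewrite exprSr -mulrA conj_a mulrA mulrDr IHn -scalerAr.
rewrite [a ^+ n * (a - 1)](_ : _ = (a - 1) * a ^+ n); last first.
  by rewrite mulrBr mulrBl mulr1 mul1r -exprS exprSr.
rewrite scalerAl -mulrDl -addrA -scalerDl -mulrA -exprSr.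
by rewrite (_ : n%:R * gamma + gamma = n.+1%:R * gamma) // -natr1 mulrDl mul1r.
Qed.

(** With y = a^-1 - 1 the conjugation rule becomes x y = y (x - gamma), hence
x^p y = y (x^p - gamma^p), and gamma^p = gamma. *)
Lemma comm_unit_expBx : GRing.comm a (x ^+ p - x).
Proof.
pose y := a^-1 - 1.
have xy : y * (x - gamma%:A) = x * y.
  have -> : x * y = a^-1 * (a * x) * a^-1 - x.
    by rewrite mulKr // mulrBr mulr1.
  rewrite conj_a mulrA mulrK // mulrBr -scalerAr mulr1.
  rewrite [a^-1 * _]mulrDr -scalerAr mulrBr mulVr // mulr1 addrAC.
  by rewrite -[1 - a^-1]opprB scalerN mulrBl mul1r.
have yx : y * (x ^+ p - gamma%:A) = x ^+ p * y.
  rewrite -(intertwineX p xy) (expr_pcharB char_A); last first.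
    exact/commr_sym/comm_alg.
  by rewrite exprZn expr1n (prime_field_expp char_k gamma_prime).
have : GRing.comm (x ^+ p - x) y.
  by rewrite /GRing.comm mulrBl -yx -xy -mulrBr opprB addrA subrK.
move/(fun h => commrD h (commr1 _)); rewrite subrK => /commrV.
by rewrite invrK => /commr_sym.
Qed.

(** Choosing n with n gamma = j, x + j (a - 1) is the conjugate of x by a^n,
whose p-th power is computed from x^p = (x^p - x) + x, the first summand being
fixed by the conjugation. *)
Let pth_power_prime (j : nat) :
  (x + j%:R *: (a - 1)) ^+ p = x ^+ p + j%:R *: (a - 1).
Proof.
have [n n_gamma] := prime_field_div char_k j gamma_prime gamma_neq0.
have := conj_aX n; rewrite n_gamma; set b := a ^+ n => bx.
apply: (@mulIr _ b); first exact: unitrX.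
rewrite -(intertwineX p bx) -[x ^+ p in LHS](subrK x) mulrDr bx.
have -> : b * (x ^+ p - x) = (x ^+ p - x) * b.
  by apply/commr_sym/commrX/commr_sym/comm_unit_expBx.
by rewrite -mulrDl addrA subrK.
Qed.

(** Over a noncommutative ring a polynomial may have more roots than its
degree; the bound holds for roots that commute and have invertible
differences, as the integers below p do. *)
Let prime_field_uniq : uniq_roots [seq n%:R : A | n <- iota 0 p].
Proof.
have: (0 + p <= p)%N by [].
move: {1 3}p => n; elim: n 0%N => [//|n IHn m]; rewrite /= addnS -addSn => le_mp.
rewrite IHn // andbT; apply/allP => _ /mapP[j j_in ->].
have{j_in} /andP[mj jp]: (m < j < m.+1 + n)%N by rewrite mem_iota in j_in.
rewrite /diff_roots (@commr_nat _ m%:R j : _ * _ = _) eqxx /= -natrB 1?ltnW //.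
rewrite -scaler_nat scaler_unit ?unitr1 // unitfE -(dvdn_pcharf char_k).
rewrite gtnNdvd ?subn_gt0 // (leq_ltn_trans (leq_subr _ _)) //.
exact: leq_trans jp le_mp.
Qed.

(** Both sides are polynomials in t, with the same coefficient in degree p since
(a - 1)^p = a^p - 1, and they agree at the p elements of the prime field. *)
Lemma pth_power_comm (t : A) : GRing.comm t x -> GRing.comm t a ->
  (x + (a - 1) * t) ^+ p
    = x ^+ p + (a - 1) * t + (a ^+ p - 1) * (t ^+ p - t).
Proof.
move=> tx ta; have p_gt1 := prime_gt1 (pcharf_prime char_k).
have bp : (a - 1) ^+ p = a ^+ p - 1.
  by rewrite (expr_pcharB char_A (commr1 a)) expr1n.
pose L : {poly A} := x%:P + (a - 1)%:P * 'X.
pose F : {poly A} := L ^+ p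
  - (x ^+ p)%:P
  - (a - 1)%:P * 'X - (a ^+ p - 1)%:P * ('X^p - 'X).
have evF s : GRing.comm s x -> GRing.comm s a -> F.[s] =
    (x + (a - 1) * s) ^+ p - x ^+ p - (a - 1) * s - (a ^+ p - 1) * (s ^+ p - s).
  move=> sx sa.
  have cL : comm_poly L s.
    rewrite /comm_poly /L !hornerE_comm; apply: commrD => //.
    apply: commrM => //; exact: commrB (commr1 _).
  rewrite /F !hornerD !hornerN horner_exp_comm //.
  by rewrite /L !hornerE_comm hornerXn.
have F0 : F = 0.
  apply/eqP; apply: contraT => nzF.
  (* In degree p the coefficients (a - 1)^p and a^p - 1 cancel. *)
  have szF : (size F <= p)%N.
    apply/leq_sizeP => j le_pj; rewrite /F.
    rewrite !coefB coef_linear_exp // !coefCM coefB coefXn coefX coefC.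
    rewrite (gtn_eqF (leq_trans p_gt1 le_pj)) (gtn_eqF (leq_trans (ltnW p_gt1) le_pj)).
    by rewrite mulr0 !subr0 mulr_natr bp subrr.
  have := @max_ring_poly_roots A F [seq n%:R | n <- iota 0 p] nzF.
  rewrite size_map size_iota ltnNge szF; apply; last exact: prime_field_uniq.
  apply/allP => _ /mapP[j _ ->].
  rewrite /root evF; try exact/commr_sym/commr_nat.
  rewrite mulr_natr -scaler_nat pth_power_prime scaler_nat.
  have -> : j%:R ^+ p = j%:R :> A := pFrobenius_aut_nat char_A j.
  by rewrite [x ^+ p + _]addrC !addrK !subrr mulr0 subrr.
have := evF t tx ta; rewrite F0 horner0 => /esym/eqP.
rewrite subr_eq0 !subr_eq => /eqP->.
by rewrite [LHS]addrC -[RHS]addrA; congr (_ + _); rewrite addrC.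
Qed.
End KeyLemma.

(** * Bases indexed by G and [0, p) *)

Lemma span_ind (k : fieldType) (U : vectType k) (X : seq U) (P : U -> Prop) :
    P 0 -> (forall z u v, P u -> P v -> P (z *: u + v)) ->
    (forall u, u \in X -> P u) ->
  forall u, u \in <<X>>%VS -> P u.
Proof.
move=> P0 P_lin P_X u /(@coord_span _ _ _ (in_tuple X))->.
elim/big_ind: _ => // [v w Pv Pw|i _]; first by rewrite -[v]scale1r; apply: P_lin.
by rewrite -[_ *: _]addr0; apply: P_lin => //; apply/P_X/mem_nth.
Qed.

Section FamilyBasis.
Variables (k : fieldType) (p : nat) (G : finType) (U : vectType k).
Variable e : G -> nat -> U.
Hypothesis e_basis : basis_of {:U} [seq e g i | g <- enum G, i <- iota 0 p].

Lemma basis_lift (W : vectType k) (F : G -> nat -> W) :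
  exists f : 'Hom(U, W), forall g i, (i < p)%N -> f (e g i) = F g i.
Proof.
have [f fP] := linear_of_free [seq e g i | g <- enum G, i <- iota 0 p]
  [seq F g i | g <- enum G, i <- iota 0 p].
have := fP (basis_free e_basis); rewrite !size_allpairs => /(_ erefl).
rewrite map_allpairs => /eq_in_allpairs eq_fF.
exists (linfun f) => g i lt_ip; rewrite lfunE /=.
by apply: eq_fF; rewrite ?mem_enum ?mem_iota.
Qed.

Lemma basis_ind (P : U -> Prop) :
    P 0 ->
    (forall z u v, P u -> P v -> P (z *: u + v)) ->
    (forall g i, (i < p)%N -> P (e g i)) ->
  forall u, P u.
Proof.
move=> P0 P_lin P_e u; have := memvf u; rewrite -(span_basis e_basis).
elim/span_ind: u / => // _ /allpairsP[[g i] /= [_ lt_ip ->]].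
by apply: P_e; rewrite mem_iota in lt_ip.
Qed.

End FamilyBasis.

Lemma free_of_map (k : fieldType) (U W : vectType k) (f : 'Hom(U, W)) X :
  free (map f X) -> free X.
Proof.
rewrite /free size_map -limg_span => /eqP dim_fX.
rewrite eqn_leq dim_span -[in leqLHS]dim_fX -(limg_ker_dim f <<X>>%VS).
exact: leq_addl.
Qed.

(** Any basis can be relabelled by pairs [(g, i)], with the position of the pair
in the enumeration as index. *)
Lemma family_basis_exists (k : fieldType) (p : nat) (G : finType)
    (U : vectType k) : \dim {:U} = (#|G| * p)%N ->
  exists e : G -> nat -> U,
    basis_of {:U} [seq e g i | g <- enum G, i <- iota 0 p].
Proof.
move=> dimU; pose s := [seq (g, i) | g <- enum G, i <- iota 0 p].
have sz_s : size s = \dim {:U} by rewrite size_allpairs size_iota -cardE dimU.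
have s_uniq : uniq s.
  by apply: allpairs_uniq; rewrite ?enum_uniq ?iota_uniq // => -[? ?] [? ?].
exists (fun g i => (vbasis {:U})`_(index (g, i) s)).
suff -> : [seq (vbasis {:U})`_(index (g, i) s) | g <- enum G, i <- iota 0 p]
    = vbasis {:U} by apply: vbasisP.
rewrite -(map_allpairs (fun z => (vbasis {:U})`_(index z s)) pair) -/s.
apply: (@eq_from_nth _ 0) => [|j]; rewrite size_map sz_s ?size_tuple // => lt_j.
have [z0 _] : exists z0, z0 \in s.
  by case: {+}s sz_s lt_j => [<-|z0 s' _ _] //; exists z0; rewrite mem_head.
by rewrite (nth_map z0) ?sz_s // index_uniq ?sz_s.
Qed.

Section ColumnOperators.
Variables (k : fieldType) (n p : nat) (G : finType).
Variable e : G -> nat -> 'cV[k]_n.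
Hypothesis e_basis : basis_of fullv [seq e g i | g <- enum G, i <- iota 0 p].

Lemma mx_of_basis (F : G -> nat -> 'cV[k]_n) :
  exists M : 'M[k]_n, forall g i, (i < p)%N -> M *m e g i = F g i.
Proof.
have [f fE] := basis_lift e_basis F.
exists (\matrix_(i, j) f (delta_mx j 0) i 0) => g i lt_ip; rewrite -fE //.
apply/colP => r; rewrite mxE [in RHS](matrix_sum_delta (e g i)).
rewrite linear_sum summxE; apply: eq_bigr => j _.
by rewrite big_ord1 linearZ !mxE mulrC.
Qed.

Lemma mx_eq_basis (M N : 'M[k]_n) :
  (forall g i, (i < p)%N -> M *m e g i = N *m e g i) -> M = N.
Proof.
move=> eqMN; have eqMNv (v : 'cV_n) : M *m v = N *m v.
  elim/(basis_ind e_basis): v => [|z u w IHu IHw|]; last exact: eqMN.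
    by rewrite !mulmx0.
  by rewrite !mulmxDr -!scalemxAr IHu IHw.
by apply/matrixP => i j; have /colP/(_ i) := eqMNv (delta_mx j 0);
  rewrite -!colE !mxE.
Qed.

End ColumnOperators.

(** * The presentation and its universal property *)

Section Presentation.
Variables (k : fieldType) (p : nat) (G : finGroupType) (a : G) (c : G -> k)
  (alpha : k).
Hypotheses (char_k : p \in [pchar k]) (aZ : a \in 'Z([set: G])%g)
  (cM : forall g h : G, c (g * h)%g = c g + c h).

(** The presentation without the basis: what the images of the generators must
satisfy in an arbitrary algebra.  The conjugation relation is stated without
inverses. *)
Record HE_relations (B : falgType k) (gen : G -> B) (x : B) : Prop :=
  HERelations {
    rel_gen1 : gen 1%g = 1;
    rel_genM : forall g h, gen (g * h)%g = gen g * gen h;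
    rel_conj : forall g, gen g * x = (x + c g *: (gen a - 1)) * gen g;
    rel_pow : x ^+ p = x + alpha *: (gen a ^+ p - 1)
  }.

Let p_gt1 : (1 < p)%N := prime_gt1 (pcharf_prime char_k).

Lemma addhom1 : c 1%g = 0.
Proof. by apply: (addrI (c 1%g)); rewrite -cM mulg1 addr0. Qed.

Lemma addhomV g : c g^-1%g = - c g.
Proof. by apply: (addrI (c g)); rewrite -cM mulgV subrr addhom1. Qed.

Lemma central_mulC g : (a * g = g * a)%g.
Proof. by have /centerP[_ /(_ g (in_setT _))] := aZ. Qed.

Section Relations.
Variables (B : falgType k) (gen : G -> B) (x : B).
Hypothesis rels : HE_relations gen x.

Lemma gen_expg g n : gen (g ^+ n)%g = gen g ^+ n.
Proof.
elim: n => [|n IHn]; first by rewrite expg0 (rel_gen1 rels).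
by rewrite expgS exprS (rel_genM rels) IHn.
Qed.

Lemma gen_mulgV g : gen g * gen g^-1%g = 1.
Proof. by rewrite -(rel_genM rels) mulgV (rel_gen1 rels). Qed.

Lemma gen_mulVg g : gen g^-1%g * gen g = 1.
Proof. by rewrite -(rel_genM rels) mulVg (rel_gen1 rels). Qed.

Lemma gen_unit g : gen g \is a GRing.unit.
Proof. by apply/unitrP; exists (gen g^-1%g); rewrite gen_mulgV gen_mulVg. Qed.

(** The straightening rules: [x_gen] and [gen_xp] rewrite any word in the
generators as a combination of the [gen g * x ^+ i] with [i < p]. *)
Lemma x_gen g : x * gen g = gen g * x - c g *: (gen (g * a)%g - gen g).
Proof.
rewrite (rel_conj rels) mulrDl -scalerAl mulrBl mul1r -(rel_genM rels) central_mulC.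
by rewrite addrK.
Qed.

Lemma gen_xp g : gen g * x ^+ p
  = gen g * x + alpha *: (gen (g * a ^+ p)%g - gen g).
Proof.
rewrite (rel_pow rels) mulrDr -scalerAr mulrBr mulr1 -gen_expg.
by rewrite -(rel_genM rels).
Qed.

End Relations.

Section Lift.
Variables (H : falgType k) (gen : G -> H) (x : H).
Hypothesis HE : is_HE p a c alpha gen x.

Lemma is_HE_relations : HE_relations gen x.
Proof.
case: HE => _ g1 gM gJ gp; split=> // g.
by rewrite -gJ -mulrA -gM mulVg g1 mulr1.
Qed.
Let rels := is_HE_relations.

Lemma HE_ind (P : H -> Prop) :
    (forall z u v, P u -> P v -> P (z *: u + v)) ->
    (forall g i, (i < p)%N -> P (gen g * x ^+ i)) ->
  forall u, P u.
Proof.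
move=> P_lin P_e; apply: (basis_ind (HE_basis HE)) => //.
rewrite -(addNr (gen 1%g * x ^+ 0)) -scaleN1r.
by apply: P_lin; apply: P_e; apply: ltnW.
Qed.

Lemma HE_gen_ind (P : H -> Prop) :
    (forall z u v, P u -> P v -> P (z *: u + v)) ->
    (forall u v, P u -> P v -> P (u * v)) ->
    (forall g, P (gen g)) -> P x ->
  forall u, P u.
Proof.
move=> P_lin PM Pg Px; apply: HE_ind => // g i _; apply: (PM) => //.
by elim: i => [|i IHi]; rewrite ?expr0 -?(rel_gen1 rels) ?exprS //; apply: (PM).
Qed.

(** The universal property.  The only candidate is the linear map f prescribed
on the basis; it is multiplicative because the same straightening rules hold in
H and in B: f is compatible with right multiplication by x, then with right
multiplication by group elements, hence by all of H. *)
Lemma HE_lift (B : falgType k) (gen' : G -> B) (x' : B) :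
    HE_relations gen' x' ->
  exists f : 'Hom(H, B), [/\ f 1 = 1, forall u v, f (u * v) = f u * f v,
    forall g, f (gen g) = gen' g & f x = x'].
Proof.
move=> rels'; have p_gt0 := ltnW p_gt1.
have [f fE] := basis_lift (HE_basis HE) (fun g i => gen' g * x' ^+ i).
have f_gen g : f (gen g) = gen' g by have:= fE g 0 p_gt0; rewrite !expr0 !mulr1.
have f_x u : f (u * x) = f u * x'.
  elim/HE_ind: u => [z u v IHu IHv|g i lt_ip].
    by rewrite mulrDl -scalerAl !linearP /= IHu IHv mulrDl -scalerAl.
  rewrite fE // -!mulrA -!exprSr.
  have [lt_i1p|] := ltnP i.+1 p; first exact: fE.
  move=> le_p_i1; have -> : i.+1 = p by apply/eqP; rewrite eqn_leq lt_ip.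
  rewrite (gen_xp rels) (gen_xp rels') linearD linearZ linearB /= !f_gen.
  by have:= fE g 1 p_gt1; rewrite !expr1 => ->.
have f_xX u i : f (u * x ^+ i) = f u * x' ^+ i.
  elim: i => [|i IHi]; first by rewrite !expr0 !mulr1.
  by rewrite !exprSr !mulrA f_x IHi.
have f_gen_r u h : f (u * gen h) = f u * gen' h.
  elim/HE_ind: u h => [z u v IHu IHv|g i _] h.
    by rewrite mulrDl -scalerAl !linearP /= IHu IHv mulrDl -scalerAl.
  (* Moving x past h changes h into h * a, hence an induction uniform in h. *)
  elim: i h => [|i IHi] h.
    by rewrite expr0 !mulr1 -(rel_genM rels) !f_gen (rel_genM rels').
  rewrite exprSr mulrA f_x -[LHS](congr1 f (mulrA _ _ _)) -[RHS]mulrA.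
  rewrite (x_gen rels) (x_gen rels') 2!mulrBr -!scalerAr mulrBr linearB linearZ /=.
  by rewrite linearB /= mulrA f_x !IHi mulrBr mulrA.
exists f; split=> //; first by rewrite -(rel_gen1 rels) f_gen (rel_gen1 rels').
  move=> u v; elim/HE_ind: v => [z v w IHv IHw|h i _].
    by rewrite mulrDr -scalerAr !linearP /= IHv IHw mulrDr -scalerAr.
  by rewrite mulrA !f_xX f_gen_r f_gen mulrA.
by have:= f_x 1; rewrite mul1r -(rel_gen1 rels) f_gen (rel_gen1 rels') mul1r.
Qed.

End Lift.
End Presentation.

Lemma linear_comp (k : fieldType) (U V W : lmodType k) (g : V -> W) (f : U -> V) :
  linear g -> linear f -> linear (fun u => g (f u)).
Proof. by move=> lg lf z u v; rewrite lf lg. Qed.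

Section Uniqueness.
Variables (k : fieldType) (p : nat) (G : finGroupType) (a : G) (c : G -> k)
  (alpha : k).
Hypotheses (char_k : p \in [pchar k]) (aZ : a \in 'Z([set: G])%g).

Lemma HE_endo_id (H : falgType k) (gen : G -> H) (x : H) (f : H -> H) :
    is_HE p a c alpha gen x -> linear f -> {morph f : u v / u * v} ->
    (forall g, f (gen g) = gen g) -> f x = x ->
  f =1 id.
Proof.
move=> HE f_lin fM f_gen f_x u.
elim/(HE_gen_ind char_k HE): u => [z u v IHu IHv|u v IHu IHv|//|//].
  by rewrite f_lin IHu IHv.
by rewrite fM IHu IHv.
Qed.

Lemma HE_unique (H H' : falgType k) (gen : G -> H) (x : H) (gen' : G -> H')
    (x' : H') :
    is_HE p a c alpha gen x -> is_HE p a c alpha gen' x' ->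
  exists f : 'AHom(H, H'),
    [/\ bijective f, forall g, f (gen g) = gen' g & f x = x'].
Proof.
move=> HE HE'.
have [f [f1 fM f_gen f_x]] := HE_lift char_k aZ HE (is_HE_relations HE').
have [f' [_ f'M f'_gen f'_x]] := HE_lift char_k aZ HE' (is_HE_relations HE).
have f_ahom : ahom_in {:H} f by apply/ahom_inP; split=> // u v _ _.
exists (AHom f_ahom); split=> //; exists f'.
  apply: (HE_endo_id (f := fun u => f' (f u)) HE) => [|u v|g|].
  - exact: linear_comp (linearP f') (linearP f).
  - by rewrite fM f'M.
  - by rewrite f_gen f'_gen.
  - by rewrite f_x f'_x.
apply: (HE_endo_id (f := fun u => f (f' u)) HE') => [|u v|g|].
- exact: linear_comp (linearP f) (linearP f').
- by rewrite f'M fM.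
- by rewrite f'_gen f_gen.
- by rewrite f'_x f_x.
Qed.

End Uniqueness.

(** * Existence: the regular representation *)

Section Existence.
Variables (k : fieldType) (p : nat) (G : finGroupType) (a : G) (c : G -> k)
  (alpha : k).
Hypotheses (char_k : p \in [pchar k]) (aZ : a \in 'Z([set: G])%g)
  (cM : forall g h : G, c (g * h)%g = c g + c h)
  (c_prime : (a ^+ p)%g <> 1%g -> forall g : G, in_prime_field (c g))
  (ca_prime : in_prime_field (c a)) (ca_neq0 : c a <> 0).

Let p_gt1 : (1 < p)%N := prime_gt1 (pcharf_prime char_k).
Let p_gt0 : (0 < p)%N := ltnW p_gt1.

Section SpanAlgebra.
Variables (B : falgType k) (T : G -> B) (X : B).
Hypothesis rels : HE_relations p a c alpha T X.
Let S := [seq T g * X ^+ i | g <- enum G, i <- iota 0 p].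

Let S_mon g i : (i < p)%N -> T g * X ^+ i \in <<S>>%VS.
Proof.
by move=> lt_ip; apply/memv_span/allpairs_f; rewrite ?mem_enum ?mem_iota.
Qed.

Let S_gen g : T g \in <<S>>%VS.
Proof. by rewrite -[T g]mulr1 -(expr0 X); apply: S_mon. Qed.

Let S_X : X \in <<S>>%VS.
Proof. by rewrite -[X]mul1r -(rel_gen1 rels) -[X]expr1; apply: S_mon. Qed.

Let S_ind (P : B -> Prop) :
    P 0 -> (forall z u v, P u -> P v -> P (z *: u + v)) ->
    (forall g i, (i < p)%N -> P (T g * X ^+ i)) ->
  forall u, u \in <<S>>%VS -> P u.
Proof.
move=> P0 P_lin P_mon; apply: span_ind => // _ /allpairsP[[g i] /= [_ lt_ip ->]].
by apply: P_mon; rewrite mem_iota in lt_ip.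
Qed.

Let S_mulX u : u \in <<S>>%VS -> u * X \in <<S>>%VS.
Proof.
elim/S_ind: u / => [|z u v Su Sv|g i lt_ip]; first by rewrite mul0r mem0v.
  by rewrite mulrDl -scalerAl memvD // memvZ.
rewrite -mulrA -exprSr; have [|le_p] := ltnP i.+1 p; first exact: S_mon.
have -> : i.+1 = p by apply/eqP; rewrite eqn_leq lt_ip.
rewrite (gen_xp rels) memvD ?memvZ ?memvB //.
by rewrite -[X in T g * X]expr1 S_mon.
Qed.

Let S_mulgen u h : u \in <<S>>%VS -> u * T h \in <<S>>%VS.
Proof.
move=> Su; elim/S_ind: u / Su h => [h|z u v Su Sv h|g i _].
- by rewrite mul0r mem0v.
- by rewrite mulrDl -scalerAl memvD // memvZ.
elim: i => [|i IHi] h; first by rewrite expr0 mulr1 -(rel_genM rels).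
rewrite exprSr -!mulrA (x_gen aZ rels) 2!mulrBr -!scalerAr 2!mulrBr.
by rewrite memvB ?memvZ ?memvB // ?mulrA ?S_mulX.
Qed.

(** The straightening rules keep products of the monomials in their span. *)
Lemma span_is_aspace : is_aspace <<S>>%VS.
Proof.
apply/andP; split; first by apply: has_algid1; rewrite -(rel_gen1 rels).
apply/prodvP => u v Su; elim/S_ind: v / => [|z v w Sv Sw|h i _].
- by rewrite mulr0 mem0v.
- by rewrite mulrDr -scalerAr memvD // memvZ.
rewrite mulrA; elim: i => [|i IHi]; first by rewrite expr0 mulr1 S_mulgen.
by rewrite exprSr mulrA S_mulX.
Qed.

Let A : {aspace B} := ASpace span_is_aspace.

Lemma HE_of_free : free S ->
  exists (H : falgType k) (gen : G -> H) (x : H), is_HE p a c alpha gen x.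
Proof.
move=> freeS; pose gen g := vsproj A (T g); pose x := vsproj A X.
have genE g : vsval (gen g) = T g by rewrite vsprojK.
have xE : vsval x = X by rewrite vsprojK.
have vM (u v : subvs_of A) : vsval (u * v) = vsval u * vsval v by [].
have v1 : vsval (1 : subvs_of A) = 1.
  by apply/eqP; rewrite [_ == _]algid_eq1 -(rel_gen1 rels).
have vX (u : subvs_of A) i : vsval (u ^+ i) = vsval u ^+ i.
  by elim: i => [|i IHi]; rewrite ?expr0 // !exprS vM IHi.
have vL z (u v : subvs_of A) :
    vsval (u + z *: (v - 1)) = vsval u + z *: (vsval v - 1).
  by rewrite -v1.
exists (subvs_of A), gen, x; split.
- have mapS : map vsval [seq gen g * x ^+ i | g <- enum G, i <- iota 0 p] = S.
    rewrite map_allpairs; apply: eq_allpairs => g i.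
    by rewrite vM vX genE xE.
  rewrite basisEfree subvf /=; apply/andP; split.
    apply: (free_of_map (f := linfun vsval)).
    by rewrite (eq_map (lfunE _)) mapS.
  by rewrite -(size_map vsval) mapS dimvf; apply: dim_span.
- by apply: val_inj; rewrite [LHS]genE [RHS]v1 (rel_gen1 rels).
- by move=> g h; apply: val_inj; rewrite [LHS]genE [RHS]vM !genE (rel_genM rels).
- move=> g; apply: val_inj; rewrite [LHS]vM [in LHS]vM !genE xE (rel_conj rels).
  by rewrite -mulrA (gen_mulgV rels) mulr1 [RHS]vL xE genE.
- apply: val_inj; rewrite [LHS]vX xE (rel_pow rels) [RHS]vL.
  by rewrite vX xE genE.
Qed.

End SpanAlgebra.

(** The left multiplications by g and x that H_E must have.  In terms of them,
R below is the defect of the relation for x^p; it commutes with the whole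
action and kills the generator v0 of the module, so it is zero. *)
Lemma regular_representation : exists n (T : G -> 'M[k]_n.+1) (X : 'M[k]_n.+1),
  HE_relations p a c alpha T X /\
  free [seq T g * X ^+ i | g <- enum G, i <- iota 0 p].
Proof.
pose n := (#|G| * p).-1.
have nE : n.+1 = (#|G| * p)%N.
  by rewrite prednK // muln_gt0 p_gt0 andbT; apply/card_gt0P; exists 1%g.
have [e e_basis] : exists e : G -> nat -> 'cV[k]_n.+1,
    basis_of fullv [seq e g i | g <- enum G, i <- iota 0 p].
  by apply: family_basis_exists; rewrite dimvf -nE; apply: muln1.
(* [ee g p] is what g x^p has to be. *)
pose ee g i := if (i < p)%N then e g i
  else e g 1%N + alpha *: (e (g * a ^+ p)%g 0%N - e g 0%N).
have /fin_all_exists[T TE] : forall h : G, exists M : 'M[k]_n.+1,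
    forall g i, (i < p)%N -> M *m e g i = e (h * g)%g i.
  by move=> h; apply: (mx_of_basis e_basis (fun g i => e (h * g)%g i)).
(* x g = g x - c(g) (g a - g), read in front of x^i. *)
have [X XE] := mx_of_basis e_basis
  (fun g i => ee g i.+1 - c g *: (e (g * a)%g i - e g i)).
have TEE h g i : (i < p.+1)%N -> T h *m ee g i = ee (h * g)%g i.
  rewrite /ee => _; case: ifP => [/TE->//|_].
  by rewrite mulmxDr -scalemxAr mulmxBr !TE // mulgA.
have T1 : T 1%g = 1.
  by apply: (mx_eq_basis e_basis) => g i lt_ip; rewrite TE // mul1g mul1mx.
have TM g h : T (g * h)%g = T g * T h.
  by apply: (mx_eq_basis e_basis) => r i lt_ip; rewrite -mulmxA !TE // mulgA.
have TX g : T g * X = (X + c g *: (T a - 1)) * T g.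
  apply: (mx_eq_basis e_basis) => h i lt_ip.
  rewrite -!mulmxA XE // TE // mulmxBr -scalemxAr mulmxBr TEE // !TE //.
  rewrite mulmxDl XE // -scalemxAl mulmxBl TE // mul1mx cM mulgA (central_mulC aZ).
  by rewrite scalerDl opprD !addrA addrAC subrK.
have T_unit g : T g \is a GRing.unit.
  by apply/unitrP; exists (T g^-1%g); rewrite -!TM mulVg mulgV.
have T_expg g m : T (g ^+ m)%g = T g ^+ m.
  by elim: m => [|m IHm]; rewrite ?expg0 // expgS exprS TM IHm.
have TXp g : T g * X ^+ p = (X ^+ p + c g *: (T a - 1)) * T g.
  rewrite (intertwineX p (TX g)); congr (_ * _).
  have -> : c g *: (T a - 1) = (T a - 1) * (c g)%:A.
    by rewrite -scalerAr mulr1.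
  rewrite (pth_power_comm char_k (T_unit a) ca_prime ca_neq0 (TX a));
    try exact: comm_alg.
  (* Either a^p = 1, or c(g) is fixed by the p-th power map. *)
  have [ap1|ap_neq1] := eqVneq (a ^+ p)%g 1%g.
    by rewrite -T_expg ap1 T1 subrr mul0r addr0.
  rewrite exprZn expr1n (prime_field_expp char_k) ?subrr ?mulr0 ?addr0 //.
  exact/c_prime/eqP.
have c_ap : c (a ^+ p)%g = 0.
  have cX m : c (a ^+ m)%g = c a *+ m.
    elim: m => [|m IHm]; first exact: addhom1 cM.
    by rewrite expgS cM IHm mulrS.
  by rewrite cX -mulr_natr (pcharf0 char_k) mulr0.
pose R := X ^+ p - X - alpha *: (T a ^+ p - 1).
have RT g : R * T g = T g * R.
  have TAp : T g * (T a ^+ p - 1) = (T a ^+ p - 1) * T g.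
    rewrite mulrBr mulrBl mulr1 mul1r -T_expg -!TM.
    by rewrite (commuteX p (esym (central_mulC aZ g))).
  rewrite /R 2!mulrBr TXp TX -scalerAr TAp scalerAl -!mulrBl; congr (_ * _).
  by rewrite opprD addrACA subrr addr0.
have RX : R * X = X * R.
  have ApX : T a ^+ p * X = X * T a ^+ p.
    by rewrite -T_expg TX c_ap scale0r addr0.
  rewrite /R !mulrBl !mulrBr -exprS -exprSr -scalerAl -scalerAr.
  by rewrite mulrBl mulrBr ApX mul1r mulr1.
pose v0 := e 1%g 0%N.
have Xv0 i : (i < p)%N -> X ^+ i *m v0 = e 1%g i.
  elim: i => [|i IHi] lt_ip; first by rewrite expr0 mul1mx.
  rewrite exprS -mulmxA IHi 1?ltnW // XE 1?ltnW // (addhom1 cM) scale0r subr0.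
  by rewrite /ee lt_ip.
have Rv0 : R *m v0 = 0.
  have Xpv0 : X ^+ p *m v0 = ee 1%g p.
    rewrite -(prednK p_gt0) exprS -mulmxA Xv0 ?prednK // XE ?prednK //.
    by rewrite (addhom1 cM) scale0r subr0.
  rewrite /R !mulmxBl -scalemxAl mulmxBl mul1mx Xpv0 -[X in X *m v0]expr1.
  rewrite Xv0 // -T_expg TE // mulg1 /ee ltnn mul1g [_ - e _ 1%N]addrAC subrr add0r.
  exact: subrr.
have R0 : R = 0.
  apply: (mx_eq_basis e_basis) => g i lt_ip; rewrite mul0mx.
  have -> : e g i = (T g * X ^+ i) *m v0 by rewrite -mulmxA Xv0 // TE // mulg1.
  have RXi : R * X ^+ i = X ^+ i * R by apply: commrX.
  by rewrite mulmxA [R *m _]mulrA RT -mulrA RXi mulrA -mulmxA Rv0 mulmx0.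
exists n, T, X; split.
  split=> //; apply/eqP.
  by rewrite addrC -subr_eq -subr_eq0 -/R R0.
(* Evaluation at v0 sends the operators g x^i to the basis e. *)
pose ev : {linear 'M[k]_n.+1 -> 'cV[k]_n.+1} := mulmxr v0.
apply: (free_of_map (f := linfun ev)); rewrite (eq_map (lfunE _)).
rewrite map_allpairs.
suff /eq_in_allpairs-> : {in enum G & iota 0 p, forall g i, ev (T g * X ^+ i) = e g i}.
  exact: basis_free e_basis.
move=> g i _; rewrite mem_iota => /andP[_ lt_ip] /=.
by rewrite -mulmxA Xv0 // TE // mulg1.
Qed.

Lemma HE_exists :
  exists (H : falgType k) (gen : G -> H) (x : H), is_HE p a c alpha gen x.
Proof.
have [n [T [X [rels freeS]]]] := regular_representation.
exact: HE_of_free rels freeS.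
Qed.

End Existence.

(** * Tensor products of linear maps and of algebras *)

Section TensTheory.
Variables (k : fieldType).

Section Bilinear.
Variables (U V : vectType k).
Implicit Types (u : U) (v : V).

Lemma tensDl u1 u2 v : tens (u1 + u2) v = tens u1 v + tens u2 v.
Proof. by have [tl _] := tens_bilin U V; have:= tl v 1 u1 u2; rewrite !scale1r. Qed.

Lemma tensDr u v1 v2 : tens u (v1 + v2) = tens u v1 + tens u v2.
Proof. by have [_ tr] := tens_bilin U V; have:= tr u 1 v1 v2; rewrite !scale1r. Qed.

Lemma tens0l v : tens (0 : U) v = 0.
Proof. by apply: (addrI (tens 0 v)); rewrite -tensDl !addr0. Qed.

Lemma tens0r u : tens u (0 : V) = 0.
Proof. by apply: (addrI (tens u 0)); rewrite -tensDr !addr0. Qed.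

Lemma tensZl z u v : tens (z *: u) v = z *: tens u v.
Proof.
have [tl _] := tens_bilin U V.
by have:= tl v z u 0; rewrite /= tens0l !addr0.
Qed.

Lemma tensZr z u v : tens u (z *: v) = z *: tens u v.
Proof.
have [_ tr] := tens_bilin U V.
by have:= tr u z v 0; rewrite /= tens0r !addr0.
Qed.

Lemma tensBl u1 u2 v : tens (u1 - u2) v = tens u1 v - tens u2 v.
Proof. by rewrite -scaleN1r tensDl tensZl scaleN1r. Qed.

Lemma tensBr u v1 v2 : tens u (v1 - v2) = tens u v1 - tens u v2.
Proof. by rewrite -scaleN1r tensDr tensZr scaleN1r. Qed.

End Bilinear.

Lemma tensX (A B : falgType k) (u : A) (v : B) n :
  tens u v ^+ n = tens (u ^+ n) (v ^+ n).
Proof.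
elim: n => [|n IHn]; first by rewrite !expr0 tens1.
by rewrite !exprS IHn tensM.
Qed.

End TensTheory.

Section TliftTheory.
Variable k : fieldType.

Lemma tlift_parametric_linear (U V : vectType k) (X W : lmodType k)
    (F : X -> U -> V -> W) (t : tensor U V) :
    (forall u v, linear (fun w => F w u v)) ->
  linear (fun w => tlift (F w) t).
Proof.
move=> F_lin z w1 w2; rewrite /tlift.
rewrite scaler_sumr -big_split /=; apply: eq_bigr => i _.
rewrite scaler_sumr -big_split /=; apply: eq_bigr => j _.
by rewrite F_lin scalerDr !scalerA mulrC.
Qed.

Lemma linear_mull (A : falgType k) (b : A) : linear (fun u => u * b).
Proof. by move=> z u v; rewrite mulrDl scalerAl. Qed.

Lemma linear_mulr (A : falgType k) (b : A) : linear (fun u => b * u).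
Proof. by move=> z u v; rewrite mulrDr scalerAr. Qed.

Lemma linearfD (U W : lmodType k) (f : U -> W) :
  linear f -> {morph f : u v / u + v}.
Proof. by move=> lf u v; have:= lf 1 u v; rewrite !scale1r. Qed.

Lemma tliftD (U V : vectType k) (W : lmodType k) (f : U -> V -> W) :
  {morph tlift f : s t / s + t}.
Proof. exact/linearfD/tlift_linear. Qed.

Lemma tlift_morphM (A B C : falgType k) (f : A -> B -> C) :
    bilin f ->
    (forall u u' v v', f (u * u') (v * v') = f u v * f u' v') ->
  {morph tlift f : s t / s * t}.
Proof.
move=> f_bilin fM s t.
apply: (tensor_ind (f := fun s => tlift f (s * t))
  (g := fun s => tlift f s * tlift f t)) => [||u v].
- exact: linear_comp (tlift_linear f) (linear_mull t).
- exact: linear_comp (linear_mull _) (tlift_linear f).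
apply: (tensor_ind (f := fun t => tlift f (tens u v * t))
  (g := fun t => tlift f (tens u v) * tlift f t)) => [||u' v'].
- exact: linear_comp (tlift_linear f) (linear_mulr _).
- exact: linear_comp (linear_mulr _) (tlift_linear f).
by rewrite tensM !tliftE.
Qed.

Lemma tens_comp_bilin (U V U' V' : vectType k) (f : U -> U') (g : V -> V') :
  linear f -> linear g -> bilin (fun u v => tens (f u) (g v)).
Proof.
have [tl tr] := tens_bilin U' V'; move=> lf lg; split=> [v|u].
  exact: (linear_comp (tl (g v)) lf).
exact: (linear_comp (tr (f u)) lg).
Qed.

Lemma tmap_linear (U V U' V' : vectType k) (f : U -> U') (g : V -> V') :
  linear (tmap f g).
Proof. exact: tlift_linear. Qed.

Lemma tmapE (U V U' V' : vectType k) (f : U -> U') (g : V -> V') u v :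
  linear f -> linear g -> tmap f g (tens u v) = tens (f u) (g v).
Proof. by move=> lf lg; apply: tliftE; apply: tens_comp_bilin. Qed.

Lemma tmap_morphM (A B A' B' : falgType k) (f : A -> A') (g : B -> B') :
    linear f -> linear g -> {morph f : u v / u * v} -> {morph g : u v / u * v} ->
  {morph tmap f g : s t / s * t}.
Proof.
move=> lf lg fM gM; apply: tlift_morphM; first exact: tens_comp_bilin.
by move=> u u' v v'; rewrite fM gM tensM.
Qed.

Section Assoc.
Variables U V W : vectType k.

Lemma tassoc_inner_bilin (w : W) :
  bilin (fun (u : U) (v : V) => tens u (tens v w)).
Proof.
have [tl tr] := tens_bilin U (tensor V W); have [tl' _] := tens_bilin V W.
by split=> [v|u]; [apply: tl | exact: linear_comp (tr u) (tl' w)].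
Qed.

Lemma tassoc_bilin : bilin (fun (t : tensor U V) (w : W) =>
  tlift (fun u v => tens u (tens v w)) t).
Proof.
split=> [w|t]; first exact: tlift_linear.
apply: tlift_parametric_linear => u v.
have [_ tr] := tens_bilin U (tensor V W); have [_ tr'] := tens_bilin V W.
exact: linear_comp (tr u) (tr' v).
Qed.

Lemma tassoc_linear : linear (@tassoc k U V W).
Proof. exact: tlift_linear. Qed.

Lemma tassocE (u : U) (v : V) (w : W) :
  tassoc (tens (tens u v) w) = tens u (tens v w).
Proof.
rewrite /tassoc tliftE; first by rewrite tliftE //; apply: tassoc_inner_bilin.
exact: tassoc_bilin.
Qed.

End Assoc.

(** [tassoc] is a lift of a lift, so multiplicativity is reduced to pure
tensors in the first two factors before the third is dealt with. *)
Lemma tassoc_morphM (A B C : falgType k) :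
  {morph @tassoc k A B C : s t / s * t}.
Proof.
apply: tlift_morphM; first exact: tassoc_bilin.
move=> s s' w w'.
pose in_w (w : C) (t : tensor A B) : tensor A (tensor B C) :=
  tlift (fun u v => tens u (tens v w)) t.
rewrite -!/(in_w _ _).
apply: (tensor_ind (f := fun s => in_w (w * w') (s * s'))
  (g := fun s => in_w w s * in_w w' s')) => [||u v].
- exact: linear_comp (tlift_linear _) (linear_mull s').
- exact: linear_comp (linear_mull _) (tlift_linear _).
apply: (tensor_ind (f := fun s' => in_w (w * w') (tens u v * s'))
  (g := fun s' => in_w w (tens u v) * in_w w' s')) => [||u' v'].
- exact: linear_comp (tlift_linear _) (linear_mulr _).
- exact: linear_comp (linear_mulr _) (tlift_linear _).
by rewrite /in_w tensM !tliftE ?tensM //; apply: tassoc_inner_bilin.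
Qed.

End TliftTheory.

(** * The images of the generators under the structure maps *)

Section LeftMultiplication.
Import FalgLfun.

(** The product of 'End(H) is composition in the order of reading: [f * g] is f
followed by g.  Thus [amulr] is a ring morphism and [amull] an anti-morphism. *)
Lemma amullX (k : fieldType) (H : falgType k) (v u : H) n :
  (amull v ^+ n) u = v ^+ n * u.
Proof.
elim: n u => [|n IHn] u; first by rewrite !expr0 mul1r lfunE.
by rewrite exprSr lfun_mulE IHn lfunE /= exprS mulrA.
Qed.

End LeftMultiplication.

Section HopfRelations.
Variables (k : fieldType) (p : nat) (G : finGroupType) (a : G) (c : G -> k)
  (alpha : k).
Hypotheses (char_k : p \in [pchar k]) (aZ : a \in 'Z([set: G])%g)
  (cM : forall g h : G, c (g * h)%g = c g + c h)
  (ca_prime : in_prime_field (c a)) (ca_neq0 : c a <> 0).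

Variables (H : falgType k) (gen : G -> H) (x : H).
Hypothesis rels : HE_relations p a c alpha gen x.

Local Notation TT := (tensor H H).

Lemma counit_relations :
  HE_relations (B := k^o) p a c alpha (fun _ => 1) 0.
Proof.
split=> [//|g h|g|]; first by rewrite mulr1.
  by rewrite mulr0 subrr scaler0 addr0 mul0r.
by rewrite expr1n subrr scaler0 addr0 expr0n eqn0Ngt prime_gt0 ?(pcharf_prime char_k).
Qed.

(** With X2 = 1 (x) x, A2 = 1 (x) a and t = x (x) 1, the image of x is
(X2 + (A2 - 1) t) + t, a sum of two commuting elements. *)
Lemma comul_relations :
  HE_relations (B := TT) p a c alpha (fun g => tens (gen g) (gen g))
    (tens x (gen a) + tens 1 x).
Proof.
split=> [|g h|g|].
- by rewrite (rel_gen1 rels) tens1.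
- by rewrite (rel_genM rels) tensM.
- rewrite mulrDr !tensM mulr1 (rel_conj rels g).
  rewrite [in tens (gen g) (_ * gen g)]mulrDl mulrDl -!scalerAl.
  rewrite -[in gen g * gen a](rel_genM rels) -(central_mulC aZ) (rel_genM rels).
  rewrite tensDl tensDr tensZl tensZr !mulrBl !mul1r.
  rewrite tensBl tensBr -addrA mulrDl -scalerAl mulrBl mul1r.
  rewrite mulrDl !tensM mul1r [RHS]addrAC -addrA; congr (_ + _).
  rewrite addrCA [RHS]addrC; congr (_ + _); rewrite -scalerDr; congr (_ *: _).
  by rewrite addrA subrK.
pose t : TT := tens x 1; pose A2 : TT := tens 1 (gen a); pose X2 : TT := tens 1 x.
have conj2 : A2 * X2 = (X2 + c a *: (A2 - 1)) * A2.
  rewrite /A2 /X2 -tens1 -tensBr -tensZr -tensDr !tensM mulr1.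
  by rewrite (rel_conj rels).
have A2_unit : A2 \is a GRing.unit.
  apply/unitrP; exists (tens 1 (gen a^-1%g)).
  by rewrite !tensM mulr1 (gen_mulgV rels) (gen_mulVg rels) tens1.
have tX2 : GRing.comm t X2 by rewrite /GRing.comm !tensM !mulr1 !mul1r.
have tA2 : GRing.comm t A2 by rewrite /GRing.comm !tensM !mulr1 !mul1r.
have -> : tens x (gen a) + tens 1 x = (X2 + (A2 - 1) * t) + t.
  by rewrite mulrBl mul1r -addrA subrK /A2 /t tensM mulr1 mul1r addrC.
have char_T : p \in [pchar TT] by rewrite (pchar_lalg TT).
rewrite (expr_pcharD char_T); last first.
  apply/commr_sym/commrD; first exact: tX2.
  by apply: commrM => //; exact: commrB (commr1 _).
rewrite (pth_power_comm char_k A2_unit ca_prime ca_neq0 conj2 tX2 tA2).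
rewrite !tensX expr1n (rel_pow rels).
set P := gen a ^+ p; set w := alpha *: (P - 1).
have eqw : tens 1 w + tens w P = alpha *: (tens P P - 1).
  rewrite /w tensZr tensZl -scalerDr tensBr tensBl tens1.
  by rewrite addrC addrA subrK.
set M := (A2 - 1) * t.
rewrite tensDr tensDl -/t -/X2 [t + tens w 1 - t]addrAC subrr add0r.
rewrite mulrBl mul1r tensM mulr1 mul1r -eqw.
rewrite [t + _]addrC -[LHS]addrA [_ - _ + (_ + _)]addrA subrK.
rewrite -!addrA; congr (_ + _).
by rewrite [LHS]addrCA [M + (t + _)]addrCA [RHS]addrC -!addrA.
Qed.

Section Antipode.
Import FalgLfun.

Let s := - (x * gen a^-1%g).

Let sa : s * gen a = - x.
Proof. by rewrite mulNr -mulrA (gen_mulVg rels) mulr1. Qed.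

(** With X, A the right multiplications by x, a and t the left multiplication by
s, the operator A t + X = (X + (A - 1) t) + t kills 1.  Its p-th power, computed
by [pth_power_comm] and evaluated at 1, gives
x^p - x + (s^p - s) a^p = 0. *)
Lemma antipode_pow : s ^+ p = s + alpha *: (gen a^-1%g ^+ p - 1).
Proof.
pose E : falgType k := 'End(H).
pose t : E := amull s; pose X : E := amulr x; pose A : E := amulr (gen a).
have conjE : A * X = (X + c a *: (A - 1)) * A.
  rewrite /A /X -rmorphM (rel_conj rels a) rmorphM /= linearD linearZ linearB /=.
  by rewrite rmorph1.
have A_unit : A \is a GRing.unit by apply: rmorph_unit; apply: (gen_unit rels).
have tX : GRing.comm t X.
  by apply/lfunP => u; rewrite !lfun_mulE !lfunE /= mulrA.
have tA : GRing.comm t A.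
  by apply/lfunP => u; rewrite !lfun_mulE !lfunE /= mulrA.
have char_E : p \in [pchar E] by rewrite (pchar_lalg E).
have tX' : GRing.comm (X + (A - 1) * t) t.
  apply/commr_sym/commrD => //; apply: commrM => //.
  exact: commrB (commr1 _).
have U0 : (((X + (A - 1) * t) + t) ^+ p) 1 = 0.
  have : ((X + (A - 1) * t) + t) 1 = 0.
    rewrite mulrBl mul1r -addrA subrK add_lfunE lfun_mulE !lfunE /=.
    by rewrite !mul1r sa subrr.
  have p_gt0 := prime_gt0 (pcharf_prime char_k).
  by rewrite -(prednK p_gt0) exprS lfun_mulE => ->; rewrite linear0.
move: U0; rewrite (expr_pcharD char_E tX').
rewrite (pth_power_comm char_k A_unit ca_prime ca_neq0 conjE tX tA).
have rE v n u : ((amulr v : E) ^+ n) u = u * v ^+ n.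
  by rewrite -rmorphXn lfunE.
have tE1 u : t u = s * u by rewrite lfunE.
rewrite !(add_lfunE, opp_lfunE, lfun_mulE, amullX, tE1, rE, id_lfunE).
rewrite lfunE /= !mul1r !mulr1 mulrBr mulr1 sa (rel_pow rels) -mulrBl.
set P := gen a ^+ p; set w := alpha *: (P - 1); set d := s ^+ p - s.
move=> sum0; have dP : d * P = - w.
  apply/eqP; rewrite -addr_eq0 addrC; apply/eqP; rewrite -{}sum0 mulrBr mulr1.
  have -> : s ^+ p = d + s by rewrite subrK.
  rewrite [x + w]addrC [w + x + _]addrA addrK.
  by rewrite -[RHS]addrA [_ - d + _]addrA subrK [_ + s]addrC addrA subrK.
have PQ : P * gen a^-1%g ^+ p = 1.
  by rewrite /P -!(gen_expg rels) -(rel_genM rels) expgVn mulgV (rel_gen1 rels).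
apply/eqP; rewrite addrC -subr_eq -/d -[d]mulr1 -PQ mulrA dP /w.
by rewrite mulNr -scalerAl mulrBl PQ mul1r -scalerN opprB.
Qed.

(** The antipode reverses products.  It is obtained from an algebra morphism
into 'End(H) that maps u to left multiplication by S(u), since [amull]
reverses products as well. *)
Lemma antipode_relations :
  HE_relations (B := 'End(H)) p a c alpha (fun g => amull (gen g^-1%g)) (amull s).
Proof.
split=> [|g h|g|].
- by rewrite invg1 (rel_gen1 rels) amull1.
- by rewrite invMg (rel_genM rels) amullM.
- have sg : s * gen g^-1%g = gen g^-1%g * (s + c g *: (gen a^-1%g - 1)).
    have -> : s * gen g^-1%g = - (x * gen g^-1%g * gen a^-1%g).
      by rewrite mulNr -!mulrA -!(rel_genM rels) -!invMg (central_mulC aZ).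
    rewrite (x_gen aZ rels) (addhomV cM) scaleNr opprK mulrDl -scalerAl mulrBl.
    rewrite (rel_genM rels) -[gen _ * gen a * _]mulrA (gen_mulgV rels) mulr1.
    by rewrite mulrDr mulrN mulrA -scalerAr mulrBr mulr1 opprD -scalerN opprB.
  apply/lfunP => u; rewrite !(lfun_mulE, add_lfunE, scale_lfunE, opp_lfunE).
  by rewrite id_lfunE !lfunE /= mulrA sg -mulrA mulrDl -scalerAl mulrBl mul1r.
- apply/lfunP => u; rewrite !(add_lfunE, scale_lfunE, opp_lfunE, amullX).
  by rewrite antipode_pow mulrDl -scalerAl mulrBl mul1r id_lfunE lfunE.
Qed.

End Antipode.
End HopfRelations.

(** * The Hopf algebra axioms *)

Section HopfStructure.
Variables (k : fieldType) (p : nat) (G : finGroupType) (a : G) (c : G -> k)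
  (alpha : k).
Hypotheses (char_k : p \in [pchar k]) (aZ : a \in 'Z([set: G])%g)
  (cM : forall g h : G, c (g * h)%g = c g + c h)
  (ca_prime : in_prime_field (c a)) (ca_neq0 : c a <> 0).

Variables (H : falgType k) (gen : G -> H) (x : H).
Hypothesis HE : is_HE p a c alpha gen x.
Let rels : HE_relations p a c alpha gen x := is_HE_relations HE.

Section Bialgebra.
Variables (D : 'Hom(H, tensor H H)) (e : 'Hom(H, k^o)).
Hypotheses (D1 : D 1 = 1) (DM : forall u v, D (u * v) = D u * D v)
  (D_gen : forall g, D (gen g) = tens (gen g) (gen g))
  (D_x : D x = tens x (gen a) + tens 1 x).
Hypotheses (e1 : e 1 = 1) (eM : forall u v, e (u * v) = e u * e v)
  (e_gen : forall g, e (gen g) = 1) (e_x : e x = 0).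

Let gen_ind := HE_gen_ind char_k HE.
Let D_lin : linear D := linearP D.
Let id_lin : linear (@id H) := fun _ _ _ => erefl.
Let id_morphM : {morph @id H : u v / u * v} := fun _ _ => erefl.

Lemma comul_coassoc u : tassoc (tmap D id (D u)) = tmap id D (D u).
Proof.
elim/gen_ind: u => [z u v IHu IHv|u v IHu IHv|g|].
- by rewrite linearP !tmap_linear tassoc_linear IHu IHv.
- rewrite DM !tmap_morphM //.
  by rewrite tassoc_morphM IHu IHv.
- by rewrite D_gen !tmapE ?linearP // !D_gen tassocE.
rewrite D_x /tmap !tliftD -!/(tmap _ _) !tmapE ?linearP // D_x D1 -tens1.
by rewrite tensDl tensDr /tassoc !tliftD -!/(tassoc _) !tassocE !D_gen addrA.
Qed.

Lemma counit_bilinl : bilin (fun v w : H => e v *: w).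
Proof.
split=> [v|u] z w1 w2; first by rewrite linearP scalerDl scalerA.
by rewrite scalerDr !scalerA mulrC.
Qed.

Lemma counit_bilinr : bilin (fun v w : H => e w *: v).
Proof. by have [el er] := counit_bilinl; split. Qed.

Lemma comul_counitl u : tlift (fun v w => e v *: w) (D u) = u.
Proof.
elim/gen_ind: u => [z u v IHu IHv|u v IHu IHv|g|].
- by rewrite linearP tlift_linear IHu IHv.
- rewrite DM tlift_morphM ?IHu ?IHv //; first exact: counit_bilinl.
  by move=> v1 v2 w1 w2; rewrite eM -scalerAl -scalerAr scalerA.
- by rewrite D_gen tliftE ?e_gen ?scale1r //; apply: counit_bilinl.
by rewrite D_x tliftD !tliftE ?e1 ?e_x ?scale0r ?add0r ?scale1r //;
  apply: counit_bilinl.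
Qed.

Lemma comul_counitr u : tlift (fun v w => e w *: v) (D u) = u.
Proof.
elim/gen_ind: u => [z u v IHu IHv|u v IHu IHv|g|].
- by rewrite linearP tlift_linear IHu IHv.
- rewrite DM tlift_morphM ?IHu ?IHv //; first exact: counit_bilinr.
  by move=> v1 v2 w1 w2; rewrite eM -scalerAl -scalerAr scalerA.
- by rewrite D_gen tliftE ?e_gen ?scale1r //; apply: counit_bilinr.
by rewrite D_x tliftD !tliftE ?e_gen ?e_x ?scale0r ?addr0 ?scale1r //;
  apply: counit_bilinr.
Qed.

Section Antipode.
Variable S : 'Hom(H, H).
Hypotheses (S1 : S 1 = 1) (SM : forall u v, S (u * v) = S v * S u)
  (S_gen : forall g, S (gen g) = gen g^-1%g)
  (S_x : S x = - (x * gen a^-1%g)).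

Lemma antipode_bilinl : bilin (fun v w : H => S v * w).
Proof.
split=> [v|u]; last exact: linear_mulr.
exact: linear_comp (linear_mull v) (linearP S).
Qed.

Lemma antipode_bilinr : bilin (fun v w : H => v * S w).
Proof.
split=> [v|u]; first exact: linear_mull.
exact: linear_comp (linear_mulr u) (linearP S).
Qed.

Let convl := tlift (fun v w => S v * w).
Let convr := tlift (fun v w => v * S w).

(** On a pure tensor v (x) w the map convl sends s (v (x) w) to
S(v) convl(s) w; once convl(s) is a scalar it factors out.  This makes the
antipode axiom stable under products. *)
Let convl_mul s z t : convl s = z%:A -> convl (s * t) = z *: convl t.
Proof.
move=> s_z; apply: (tensor_ind (f := fun t => convl (s * t))
  (g := fun t => z *: convl t)) => [||v w].
- exact: linear_comp (tlift_linear _) (linear_mulr s).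
- apply: linear_comp (tlift_linear _) => y u1 u2.
  by rewrite scalerDr !scalerA mulrC.
transitivity (S v * convl s * w); last first.
  by rewrite s_z -scalerAr mulr1 -scalerAl /convl tliftE //; apply: antipode_bilinl.
apply: (tensor_ind (f := fun s => convl (s * tens v w))
  (g := fun s => S v * convl s * w)) => [||v' w'].
- exact: linear_comp (tlift_linear _) (linear_mull _).
- apply: linear_comp (linear_mull w) _.
  exact: linear_comp (linear_mulr _) (tlift_linear _).
by rewrite tensM /convl !tliftE ?SM ?mulrA //; apply: antipode_bilinl.
Qed.

Let convr_mul s z t : convr t = z%:A -> convr (s * t) = z *: convr s.
Proof.
move=> t_z; apply: (tensor_ind (f := fun s => convr (s * t))
  (g := fun s => z *: convr s)) => [||v w].
- exact: linear_comp (tlift_linear _) (linear_mull t).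
- apply: linear_comp (tlift_linear _) => y u1 u2.
  by rewrite scalerDr !scalerA mulrC.
transitivity (v * convr t * S w); last first.
  by rewrite t_z -scalerAr mulr1 -scalerAl /convr tliftE //; apply: antipode_bilinr.
apply: (tensor_ind (f := fun t => convr (tens v w * t))
  (g := fun t => v * convr t * S w)) => [||v' w'].
- exact: linear_comp (tlift_linear _) (linear_mulr _).
- apply: linear_comp (linear_mull _) _.
  exact: linear_comp (linear_mulr _) (tlift_linear _).
by rewrite tensM /convr !tliftE ?SM ?mulrA //; apply: antipode_bilinr.
Qed.

Lemma comul_antipodel u : convl (D u) = e u *: 1.
Proof.
elim/gen_ind: u => [z u v IHu IHv|u v IHu IHv|g|].
- by rewrite !linearP /convl tlift_linear -/convl IHu IHv scalerDl scalerA.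
- by rewrite DM (convl_mul _ IHu) IHv eM scalerA.
- rewrite D_gen /convl tliftE; last exact: antipode_bilinl.
  by rewrite S_gen (gen_mulVg rels) e_gen scale1r.
rewrite D_x /convl tliftD !tliftE; try exact: antipode_bilinl.
by rewrite S1 S_x mul1r mulNr -mulrA (gen_mulVg rels) mulr1 addNr e_x scale0r.
Qed.

Lemma comul_antipoder u : convr (D u) = e u *: 1.
Proof.
elim/gen_ind: u => [z u v IHu IHv|u v IHu IHv|g|].
- by rewrite !linearP /convr tlift_linear -/convr IHu IHv scalerDl scalerA.
- by rewrite DM (convr_mul _ IHv) IHu eM scalerA mulrC.
- rewrite D_gen /convr tliftE; last exact: antipode_bilinr.
  by rewrite S_gen (gen_mulgV rels) e_gen scale1r.
rewrite D_x /convr tliftD !tliftE; try exact: antipode_bilinr.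
by rewrite S_gen S_x mul1r subrr e_x scale0r.
Qed.

Lemma HE_is_hopf : is_hopf_algebra (HopfMaps D e S).
Proof.
split=> //=.
- exact: comul_coassoc.
- exact: comul_counitl.
- exact: comul_counitr.
- exact: comul_antipodel.
- exact: comul_antipoder.
Qed.

Lemma HE_has_formulas : HE_formulas p a gen x (HopfMaps D e S).
Proof.
split=> g i _ /=.
- by rewrite DM D_gen; congr (_ * _); elim: i => [|i IHi];
    rewrite ?expr0 // !exprS DM D_x IHi.
- rewrite eM e_gen mul1r; case: i => [|i]; first by rewrite expr0 e1.
  by rewrite exprS eM e_x mul0r.
- rewrite SM S_gen; congr (_ * _); elim: i => [|i IHi]; first by rewrite !expr0.
  by rewrite exprS SM S_x IHi -exprSr.
Qed.

End Antipode.
End Bialgebra.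

Import FalgLfun.

Lemma antipode_exists : exists S : 'Hom(H, H),
  [/\ S 1 = 1, forall u v, S (u * v) = S v * S u,
      forall g, S (gen g) = gen g^-1%g & S x = - (x * gen a^-1%g)].
Proof.
have [psi [psi1 psiM psi_gen psi_x]] := HE_lift char_k aZ HE
  (antipode_relations char_k aZ cM ca_prime ca_neq0 rels).
have ev_lin : linear (fun u => psi u 1).
  by move=> z u v; rewrite linearP add_lfunE scale_lfunE.
pose S0 : {linear H -> H} := HB.pack (fun u => psi u 1)
  (GRing.isLinear.Build k H H _ (fun u => psi u 1) ev_lin).
have SE u : linfun S0 u = psi u 1 by rewrite lfunE.
have psiE u v : psi u v = psi u 1 * v.
  elim/(HE_gen_ind char_k HE): u v => [z u w IHu IHw|u w IHu IHw|g|] v.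
  - by rewrite linearP !add_lfunE !scale_lfunE IHu IHw mulrDl scalerAl.
  - by rewrite psiM !lfun_mulE IHw IHu [psi w (psi u 1)]IHw mulrA.
  - by rewrite psi_gen !lfunE /= mulr1.
  - by rewrite psi_x !lfunE /= mulr1.
exists (linfun S0); split=> [|u v|g|]; rewrite !SE.
- by rewrite psi1 lfunE.
- by rewrite psiM lfun_mulE [LHS]psiE.
- by rewrite psi_gen lfunE /= mulr1.
- by rewrite psi_x lfunE /= mulr1.
Qed.

Lemma HE_hopf_exists_unique : exists! D : hopf_maps H,
  HE_formulas p a gen x D /\ is_hopf_algebra D.
Proof.
have [D [D1 DM D_gen D_x]] := HE_lift char_k aZ HE
  (comul_relations char_k aZ ca_prime ca_neq0 rels).
have [e [e1 eM e_gen e_x]] := HE_lift char_k aZ HE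
  (counit_relations a c alpha char_k).
have [S [S1 SM S_gen S_x]] := antipode_exists.
exists (HopfMaps D e S); split; first by split;
  [exact: HE_has_formulas | exact: HE_is_hopf].
case=> D' e' S' [[D'E e'E S'E] _].
have [DE eE SE] := HE_has_formulas D1 DM D_gen D_x e1 eM e_gen e_x S1 SM S_gen S_x.
have eq_hom (W : vectType k) (f f' : 'Hom(H, W)) :
    (forall g i, (i < p)%N -> f (gen g * x ^+ i) = f' (gen g * x ^+ i)) ->
  f = f'.
  move=> eq_ff'; apply/lfunP => u; elim/(HE_ind char_k HE): u => [z u v IHu IHv|].
    by rewrite !linearP /= IHu IHv.
  exact: eq_ff'.
congr HopfMaps; apply: eq_hom => g i lt_ip.
- by rewrite [LHS]DE // [RHS]D'E.
- by rewrite [LHS]eE // [RHS]e'E.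
- by rewrite [LHS]SE // [RHS]S'E.
Qed.

End HopfStructure.

(** * The Hopf algebra H_E is well defined *)

Theorem lemma4p14 (k : fieldType) (p : nat) (char_k : p \in [pchar k])
    (G : finGroupType) (a : G) (c : G -> k) (alpha : k)
    (aZ : a \in 'Z([set: G])%g)
    (p_dvd_a : (p %| #[a]%g)%N)
    (cM : forall g h : G, c (g * h)%g = c g + c h)
    (c_prime : (a ^+ p)%g <> 1%g -> forall g : G, in_prime_field (c g))
    (* c(a) is a nonzero element of the prime field: necessary for the claim *)
    (ca_prime : in_prime_field (c a)) (ca_neq0 : c a <> 0) :
  [/\ (* existence of the algebra *)
      exists (H : falgType k) (gen : G -> H) (x : H),
        is_HE p a c alpha gen x,
      (* its uniqueness up to isomorphism *)
      forall (H H' : falgType k) (gen : G -> H) (x : H)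
             (gen' : G -> H') (x' : H'),
        is_HE p a c alpha gen x -> is_HE p a c alpha gen' x' ->
        exists f : 'AHom(H, H'),
          [/\ bijective f, forall g, f (gen g) = gen' g & f x = x']
    & (* existence and uniqueness of the Hopf algebra structure *)
      forall (H : falgType k) (gen : G -> H) (x : H),
        is_HE p a c alpha gen x ->
        exists! D : hopf_maps H,
          HE_formulas p a gen x D /\ is_hopf_algebra D].
Proof.
split.
- exact: HE_exists char_k aZ cM c_prime ca_prime ca_neq0.
- by move=> H H' gen x gen' x'; apply: HE_unique.
- by move=> H gen x; apply: HE_hopf_exists_unique.
Qed.
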